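(* Let $L$ be an effect algebra. If $L$ has the Grothendieck property and the Nikodým property, then $L$ has the Vitali-Hahn-Saks property. Likewise, if $L$ has the $\sigma$-Grothendieck property and the $\sigma$-Nikodým property, then $L$ has the $\sigma$-Vitali-Hahn-Saks property.
   Context: An effect algebra $(L,\oplus,0,1)$ is a set $L$ with elements $0,1\in L$ and a partial binary operation $\oplus$ such that for all $p,q,r\in L$: (E1) if $p\oplus q$ is defined then $q\oplus p$ is defined and equal to it; (E2) if $q\oplus r$ and $p\oplus(q\oplus r)$ are defined then $p\oplus q$ and $(p\oplus q)\oplus r$ are defined and $(p\oplus q)\oplus r=p\oplus(q\oplus r)$; (E3) for every $p$ there is a unique $q$ with $p\oplus q=1$; (E4) if $1\oplus p$ is defined then $p=0$. The partial order on $L$ is: $p\le q$ iff there is $r$ with $p\oplus r=q$. Elements $p,q$ are orthogonal if $p\oplus q$ is defined. Finite orthosums are defined inductively (independent of the order). A sequence $(a_n)_{n\in\mathbb{N}}$ in $L$ is orthogonal if for every finite set $F$ of indices $\bigoplus_{n\in F}a_n$ exists; $\bigoplus_{n\in\mathbb{N}}a_n$ denotes the supremum of $\{\bigoplus_{n\in F}a_n: F\subset\mathbb{N}\text{ finite}\}$ in $L$, if it exists. A (real-valued) measure is a map $\mu:L\to\mathbb{R}$ with $\mu(a\oplus b)=\mu(a)+\mu(b)$ for orthogonal $a,b$; it is bounded if $\sup_{a\in L}|\mu(a)|<\infty$; it is $\sigma$-additive if $\mu(\bigoplus_{n}a_n)=\sum_{n}\mu(a_n)$ for every orthogonal sequence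 $(a_n)$ such that $\bigoplus_n a_n$ exists. A sequence $(\mu_i)_{i\in\mathbb{N}}$ of measures is: pointwise bounded if for each $a\in L$, $\sup_i|\mu_i(a)|<\infty$; uniformly bounded if $\sup_{i}\sup_{a\in L}|\mu_i(a)|<\infty$; pointwise convergent if $\lim_i\mu_i(a)$ exists (in $\mathbb{R}$) for every $a\in L$; uniformly exhaustive if for every orthogonal sequence $(a_n)$, $\lim_n\mu_i(a_n)=0$ uniformly in $i$; uniformly strongly additive if for every orthogonal sequence $(a_n)$, the partial sums $\sum_{k=1}^n\mu_i(a_k)$ converge as $n\to\infty$ uniformly in $i$. $L$ has: the Nikodým property if every pointwise bounded sequence of bounded real-valued measures on $L$ is uniformly bounded; the Vitali-Hahn-Saks property if every pointwise convergent sequence of bounded real-valued measures on $L$ is uniformly exhaustive; the Grothendieck property if every pointwise convergent and uniformly bounded sequence of bounded real-valued measures on $L$ is uniformly strongly additive. The $\sigma$-Nikodým, $\sigma$-Vitali-Hahn-Saks and $\sigma$-Grothendieck properties are the same conditions required only for sequences of bounded $\sigma$-additive real-valued measures. *)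

(* Defs.v *)
From HB Require Import structures.
From mathcomp Require Import all_boot all_order all_algebra finmap.
From mathcomp Require Import all_classical all_reals all_analysis.

Set Implicit Arguments.
Unset Strict Implicit.
Unset Printing Implicit Defensive.

Import Order.TTheory GRing.Theory Num.Theory.
Import numFieldNormedType.Exports.

Local Open Scope classical_set_scope.
Local Open Scope ring_scope.

(* [eadd p q = Some r] means that p (+) q is defined and equal to r;
   [eadd p q = None] means that it is undefined. *)
Record effectAlgebra := EffectAlgebra {
  ea_sort :> Type;
  eadd : ea_sort -> ea_sort -> option ea_sort;
  ezero : ea_sort;
  eone : ea_sort;
  eaddC : forall p q r, eadd p q = Some r -> eadd q p = Some r;
  eaddA : forall p q r qr pqr, eadd q r = Some qr -> eadd p qr = Some pqr ->
    exists pq, eadd p q = Some pq /\ eadd pq r = Some pqr;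
  eorthosuppl : forall p, exists! q, eadd p q = Some eone;
  eone_max : forall p r, eadd eone p = Some r -> p = ezero
}.

Arguments ezero {e}.
Arguments eone {e}.

Definition ele (L : effectAlgebra) (p q : L) : Prop :=
  exists r, eadd p r = Some q.

Definition eis_sup (L : effectAlgebra) (A : set L) (s : L) : Prop :=
  (forall x, A x -> ele x s) /\
  (forall u, (forall x, A x -> ele x u) -> ele s u).

(* (..((0 (+) x_1) (+) x_2)..) (+) x_n, undefined as soon as one step is *)
Definition orthosum_seq (L : effectAlgebra) (s : seq L) : option L :=
  foldl (fun acc x => obind (fun y => eadd y x) acc) (Some ezero) s.

(* F is listed in its canonical enumeration; by [eaddC] and [eaddA] the
   orthosum does not depend on the order of summation. *)
Definition orthosum (L : effectAlgebra) (a : nat -> L) (F : {fset nat}) :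
  option L := orthosum_seq [seq a n | n <- enum_fset F].

Definition orthogonal_seq (L : effectAlgebra) (a : nat -> L) : Prop :=
  forall F : {fset nat}, exists x, orthosum a F = Some x.

Definition is_inf_orthosum (L : effectAlgebra) (a : nat -> L) (s : L) : Prop :=
  eis_sup [set x | exists F : {fset nat}, orthosum a F = Some x] s.

Definition is_emeasure (R : realType) (L : effectAlgebra) (mu : L -> R) :
  Prop := forall a b c, eadd a b = Some c -> mu c = mu a + mu b.

Definition bounded_emeasure (R : realType) (L : effectAlgebra) (mu : L -> R) :
  Prop := is_emeasure mu /\ (ereal_sup [set `|mu a|%:E | a in setT] < +oo)%E.

Definition esigma_additive (R : realType) (L : effectAlgebra) (mu : L -> R) :
  Prop := forall (a : nat -> L) (s : L),
    orthogonal_seq a -> is_inf_orthosum a s ->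
    series (fun n => mu (a n)) @ \oo --> mu s.

Definition bounded_sigma_emeasure (R : realType) (L : effectAlgebra)
  (mu : L -> R) : Prop := bounded_emeasure mu /\ esigma_additive mu.

Definition pointwise_bounded (R : realType) (L : effectAlgebra)
    (mu : nat -> L -> R) : Prop :=
  forall a, (ereal_sup [set `|mu i a|%:E | i in setT] < +oo)%E.

Definition uniformly_bounded (R : realType) (L : effectAlgebra)
    (mu : nat -> L -> R) : Prop :=
  (ereal_sup [set ereal_sup [set `|mu i a|%:E | a in setT] | i in setT]
    < +oo)%E.

Definition pointwise_convergent (R : realType) (L : effectAlgebra)
    (mu : nat -> L -> R) : Prop :=
  forall a, cvg (mu i a @[i --> \oo]).

Definition uniformly_exhaustive (R : realType) (L : effectAlgebra)
    (mu : nat -> L -> R) : Prop :=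
  forall a : nat -> L, orthogonal_seq a ->
    {uniform, (fun n i : nat => mu i (a n)) @ \oo --> (fun _ : nat => 0 : R)}.

Definition uniformly_strongly_additive (R : realType) (L : effectAlgebra)
    (mu : nat -> L -> R) : Prop :=
  forall a : nat -> L, orthogonal_seq a ->
    exists S : nat -> R,
      {uniform, (fun n i : nat => series (fun k => mu i (a k)) n) @ \oo --> S}.

Definition nikodym_for (R : realType) (L : effectAlgebra)
    (C : (L -> R) -> Prop) : Prop :=
  forall mu : nat -> L -> R, (forall i, C (mu i)) ->
    pointwise_bounded mu -> uniformly_bounded mu.

Definition vitali_hahn_saks_for (R : realType) (L : effectAlgebra)
    (C : (L -> R) -> Prop) : Prop :=
  forall mu : nat -> L -> R, (forall i, C (mu i)) ->
    pointwise_convergent mu -> uniformly_exhaustive mu.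

Definition grothendieck_for (R : realType) (L : effectAlgebra)
    (C : (L -> R) -> Prop) : Prop :=
  forall mu : nat -> L -> R, (forall i, C (mu i)) ->
    pointwise_convergent mu -> uniformly_bounded mu ->
    uniformly_strongly_additive mu.

Definition nikodym_property (R : realType) (L : effectAlgebra) : Prop :=
  nikodym_for (@bounded_emeasure R L).
Definition vitali_hahn_saks_property (R : realType) (L : effectAlgebra) :
  Prop := vitali_hahn_saks_for (@bounded_emeasure R L).
Definition grothendieck_property (R : realType) (L : effectAlgebra) : Prop :=
  grothendieck_for (@bounded_emeasure R L).

Definition sigma_nikodym_property (R : realType) (L : effectAlgebra) : Prop :=
  nikodym_for (@bounded_sigma_emeasure R L).
Definition sigma_vitali_hahn_saks_property (R : realType)
  (L : effectAlgebra) : Prop :=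
  vitali_hahn_saks_for (@bounded_sigma_emeasure R L).
Definition sigma_grothendieck_property (R : realType) (L : effectAlgebra) :
  Prop := grothendieck_for (@bounded_sigma_emeasure R L).

(* Main.v *)
Require Import Defs.
From mathcomp Require Import all_boot all_order all_algebra.
From mathcomp Require Import all_classical all_reals all_analysis.

(** A pointwise convergent sequence of measures is pointwise bounded, hence
    uniformly bounded by the Nikodym property, so the Grothendieck property
    applies.  Uniform strong additivity in turn gives uniform exhaustivity,
    since [mu_i (a_n)] is the difference of two consecutive partial sums. *)

Set Implicit Arguments.
Unset Strict Implicit.
Unset Printing Implicit Defensive.

Import Order.TTheory GRing.Theory Num.Theory.
Import numFieldNormedType.Exports.

Local Open Scope classical_set_scope.
Local Open Scope ring_scope.

Lemma has_ubound_ereal_sup_lty (R : realType) (A : set R) :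
  has_ubound A -> (ereal_sup (EFin @` A) < +oo)%E.
Proof.
move=> [M AM]; apply: (@le_lt_trans _ _ M%:E); last exact: ltry.
by apply: ge_ereal_sup => _ [x /AM xM <-]; rewrite lee_fin.
Qed.

Section UniformConvergence.
Context {K : numFieldType} {V : pseudoMetricNormedZmodType K}.
Context {I : Type} {T : choiceType} {F : set_system I} {FF : Filter F}.
Implicit Types (f : I -> T -> V) (g : T -> V).

Lemma uniform_cvgrPdist_lt f g :
  {uniform, f @ F --> g} <->
  forall eps, 0 < eps -> \forall i \near F, forall t, `|g t - f i t| < eps.
Proof.
rewrite uniform_nbhsT.
apply: (iff_trans (@cvg_ballP K (arrow_uniform_type T V) _ _ _ f g)).
by split=> fg eps /fg; apply: filterS => i + t => /(_ t); rewrite -ball_normE.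
Qed.

Lemma uniform_cvgB f1 f2 g1 g2 :
  {uniform, f1 @ F --> g1} -> {uniform, f2 @ F --> g2} ->
  {uniform, (fun i => f1 i \- f2 i) @ F --> g1 \- g2}.
Proof.
move=> /uniform_cvgrPdist_lt fg1 /uniform_cvgrPdist_lt fg2.
apply/uniform_cvgrPdist_lt => eps eps_gt0.
have eps2_gt0 : 0 < eps / 2 by rewrite divr_gt0.
apply: filterS2 (fg1 _ eps2_gt0) (fg2 _ eps2_gt0) => i fg1i fg2i t /=.
rewrite opprD addrACA -opprD.
by rewrite (le_lt_trans (ler_normB _ _))// (splitr eps) ltrD.
Qed.

End UniformConvergence.

Lemma uniform_series_cvg0 (K : numFieldType) (V : pseudoMetricNormedZmodType K)
    (T : choiceType) (u : nat -> T -> V) (s : T -> V) :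
  {uniform, (fun n t => series (u ^~ t) n) @ \oo --> s} ->
  {uniform, u @ \oo --> (fun=> 0)}.
Proof.
move=> us.
have usS : {uniform, (fun n t => series (u ^~ t) n.+1) @ \oo --> s}.
  exact: cvg_comp (cvg_addnl 1) us.
have sB0 : s \- s = fun=> 0 by apply/funext => t /=; rewrite subrr.
have uE : u = fun n => (fun t => series (u ^~ t) n.+1) \-
                       (fun t => series (u ^~ t) n).
  by apply/funext => n; apply/funext => t /=; rewrite seriesSB.
by rewrite uE -sB0; exact: uniform_cvgB usS us.
Qed.

Section MeasureSequences.
Variables (R : realType) (L : effectAlgebra).
Implicit Type mu : nat -> L -> R.

Lemma pointwise_convergent_bounded mu :
  pointwise_convergent mu -> Defs.pointwise_bounded mu.
Proof.
move=> mu_cvg a; have := has_ubound_ereal_sup_lty (cvg_has_ub (mu_cvg a)).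
by rewrite image_comp.
Qed.

Lemma uniformly_strongly_additive_exhaustive mu :
  uniformly_strongly_additive mu -> uniformly_exhaustive mu.
Proof. by move=> mu_add a /mu_add[s]; exact: uniform_series_cvg0. Qed.

Lemma grothendieck_nikodym_vitali_hahn_saks (C : (L -> R) -> Prop) :
  grothendieck_for C -> nikodym_for C -> vitali_hahn_saks_for C.
Proof.
move=> groC nikC mu muC mu_cvg; apply: uniformly_strongly_additive_exhaustive.
by apply: groC => //; apply: nikC => //; exact: pointwise_convergent_bounded.
Qed.

End MeasureSequences.

Theorem theorem3p2 (R : realType) (L : effectAlgebra) :
  (grothendieck_property R L -> nikodym_property R L ->
     vitali_hahn_saks_property R L) /\
  (sigma_grothendieck_property R L -> sigma_nikodym_property R L ->
     sigma_vitali_hahn_saks_property R L).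
Proof. by split; exact: grothendieck_nikodym_vitali_hahn_saks. Qed.
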